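(* Assume Dickson's conjecture. Then for every $k,N\in\mathbb{N}$ and every set $A\subseteq[1,N]\cap\mathbb{P}_k$, there exists $n\in\mathbb{N}$ such that $$[n+1,n+N]\cap\mathbb{P}_{k+1}=\{n+a: a\in A\}.$$ In particular, $X_{\mathbf{1}_{\mathbb{P}_k}}\subseteq X_{\mathbf{1}_{\mathbb{P}_{k+1}}}$ for every $k\in\mathbb{N}$.
   Context: $\mathbb{N}=\{1,2,\ldots\}$. $\mathbb{P}_k=\{n\in\mathbb{Z}:\Omega(n)=k\}$, where $\Omega(n)$ is the number of prime divisors of $|n|$ counted with multiplicity ($n\ne0$). Intervals are intervals of integers. For $y\in\{0,1\}^{\mathbb{Z}}$, $X_y:=\overline{\{S^jy:j\in\mathbb{Z}\}}$, where $S$ is the left shift on $\{0,1\}^{\mathbb{Z}}$; $\mathbf{1}_{\mathbb{P}_k}\in\{0,1\}^{\mathbb{Z}}$ is the indicator function of $\mathbb{P}_k$. Dickson's conjecture: let $\Phi=\{f_i(x)=a_i+b_ix: i=1,\ldots,l\}$ be a finite family of linear polynomials with $a_i,b_i\in\mathbb{Z}$, $b_i\ge1$. If for every prime $p$ there is $y\in\mathbb{Z}$ with $\prod_{i=1}^l f_i(y)\not\equiv0\bmod p$, then there are infinitely many natural numbers $m$ such that $f_1(m),\ldots,f_l(m)$ are all primes. *)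

(* Defs.v *)
From mathcomp Require Import all_boot all_order all_algebra.
From mathcomp Require Import all_classical all_reals all_analysis.

Set Implicit Arguments.
Unset Strict Implicit.
Unset Printing Implicit Defensive.

Import Order.TTheory GRing.Theory Num.Theory.

Local Open Scope classical_set_scope.
Local Open Scope ring_scope.

(* [prime_decomp m] lists the pairs (p, e) with p prime and e > 0 its exact
   exponent in m; Omega 0 = 0 is a junk value, discarded in [almost_prime]. *)
Definition Omega (n : int) : nat :=
  (\sum_(pe <- prime_decomp `|n|%N) pe.2)%N.

Definition almost_prime (k : nat) : pred int :=
  fun n => (n != 0) && (Omega n == k).

Definition Pset (k : nat) : set int := [set n : int | almost_prime k n].

(* A prime value is a positive prime. *)
Definition Dickson_conjecture : Prop :=
  forall (l : nat) (a b : 'I_l -> int),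
    (forall i, 1 <= b i) ->
    (forall p : nat, prime p ->
       exists y : int, ~~ (p%:Z %| \prod_(i < l) (a i + b i * y))%Z) ->
    infinite_set [set m : nat | (0 < m)%N /\
      forall i : 'I_l, exists2 q : nat, prime q & a i + b i * m%:Z = q%:Z].

(* {0,1}^Z with the product of the discrete topologies. *)
Notation biseq := (prod_topology (fun _ : int => bool)).

Definition shift (y : biseq) : biseq := fun n : int => y (n + 1).

Definition shift_inv (y : biseq) : biseq := fun n : int => y (n - 1).

Lemma shiftK : cancel shift shift_inv.
Proof. by move=> y; apply/funext => n; rewrite /shift_inv /shift subrK. Qed.

Lemma shift_invK : cancel shift_inv shift.
Proof. by move=> y; apply/funext => n; rewrite /shift_inv /shift addrK. Qed.

(* [Negz m] is the integer - m.+1. *)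
Definition shiftz (j : int) (y : biseq) : biseq :=
  match j with
  | Posz m => iter m shift y
  | Negz m => iter m.+1 shift_inv y
  end.

Lemma shiftzE (j : int) (y : biseq) (n : int) : shiftz j y n = y (n + j).
Proof.
case: j => m; rewrite /shiftz.
  elim: m n => [|m IHm] n; first by rewrite addr0.
  by rewrite iterS /shift IHm -addrA -natz nat1r natz.
rewrite NegzE; elim: m.+1 n => [|{}m IHm] n; first by rewrite oppr0 addr0.
by rewrite iterS /shift_inv IHm -addrA -opprD -natz nat1r natz.
Qed.

Definition orbit_closure (y : biseq) : set biseq :=
  closure [set shiftz j y | j in [set: int]].

Definition indicP (k : nat) : biseq := fun n : int => almost_prime k n.

(* Main.v *)
(* Let A be a set of elements of P_k in the window [-N, N].  Require that
   (N!)^2 divides n, and that n + b is divisible by the (k+2)nd power of a prime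
   q_b > 2N for each b of the window outside A, so that n + b is not in P_{k+1};
   the Chinese remainder theorem makes this an arithmetic progression of n.
   For a in A, n + a = |a| (sgn a + n / |a|), and Dickson's conjecture makes the
   second factors simultaneously prime, so that n + a is in P_{k+1}.  There is
   no local obstruction: modulo p <= N these factors are the units sgn a; modulo
   p = q_b, n + a = a - b is nonzero; modulo any other p one can take n = 0.
   The window is symmetric, and not just [1, N], because the blocks of the
   indicator of P_k that occur in its orbit closure may straddle 0. *)
Require Import Defs.
From mathcomp Require Import all_boot all_order all_algebra.
From mathcomp Require Import all_classical all_reals all_analysis.
From mathcomp Require Import zify ring.
Set Implicit Arguments.
Unset Strict Implicit.
Unset Printing Implicit Defensive.
Import Order.TTheory GRing.Theory Num.Theory.
Local Open Scope classical_set_scope.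
Local Open Scope ring_scope.

(** Primes not dividing [n] contribute exponent 0. A range of indices shared by several integers
    lets additivity of [Omega] be checked prime by prime. *)
Lemma OmegaE (n : int) (B : nat) : n != 0 -> (`|n| < B)%N ->
  Omega n = (\sum_(p <- iota 0 B) logn p `|n|)%N.
Proof.
move=> n0 nB; rewrite /Omega prime_decompE big_map /=.
rewrite [RHS](bigID (mem (primes `|n|))) /= [X in (_ + X)%N]big1 ?addn0;
  last first.
  by move=> p; rewrite -logn_gt0 lt0n negbK => /eqP.
rewrite -[RHS]big_filter; apply: perm_big; apply: uniq_perm.
- exact: primes_uniq.
- by rewrite filter_uniq ?iota_uniq.
- move=> p; rewrite mem_filter mem_iota /= add0n.
  case: (boolP (p \in primes _)) => //=.
  rewrite mem_primes => /and3P[_ ngt0 /(dvdn_leq ngt0) pn].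
  by rewrite (leq_ltn_trans pn nB).
Qed.

Lemma OmegaM (m n : int) : m != 0 -> n != 0 ->
  Omega (m * n) = (Omega m + Omega n)%N.
Proof.
move=> m0 n0; have mn0 : m * n != 0 by rewrite mulf_neq0.
set B := ((`|m| + `|n| + `|(m * n)%R|).+1)%N.
rewrite !(@OmegaE _ B) //; try by rewrite /B; lia.
rewrite -big_split /=; apply: eq_bigr => p _.
by rewrite abszM lognM ?absz_gt0.
Qed.

Lemma Omega_prime (p : nat) : prime p -> Omega p%:Z = 1%N.
Proof.
by move=> pp; rewrite /Omega prime_decompE primes_prime //= big_seq1 /=
  logn_prime ?eqxx.
Qed.

Lemma Omega_primeX (p e : nat) : prime p -> Omega (p ^ e)%N%:Z = e.
Proof.
move=> pp; elim: e => [|e IHe]; first by rewrite /Omega /= big_nil.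
by rewrite expnS PoszM OmegaM ?IHe ?Omega_prime // -lt0n ?expn_gt0 prime_gt0.
Qed.

Lemma leq_Omega_dvd (m n : int) :
  n != 0 -> (m %| n)%Z -> (Omega m <= Omega n)%N.
Proof.
move=> + /dvdzP[c nE]; rewrite nE mulf_eq0 negb_or => /andP[c0 m0].
by rewrite OmegaM // leq_addl.
Qed.

(** Induction on [s]: each new entry receives a fresh prime exceeding [D + M], hence coprime to the
    current modulus [M], and the Chinese remainder theorem corrects [n0]. The last clause keeps
    track of the primes of [M], where local obstructions must be excluded. *)
Lemma simultaneous_prime_powers (D K L : nat) (s : seq int) : (0 < L)%N ->
  exists (M : nat) (n0 : int), [/\ (0 < M)%N, (L %| M)%N, (L%:Z %| n0)%Z,
    forall b, b \in s -> exists2 q : nat, prime q &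
      (q ^ K %| M)%N /\ ((q ^ K)%N%:Z %| n0 + b)%Z &
    forall p : nat, prime p -> (p %| M)%N -> (p %| L)%N \/
      (D < p)%N /\ exists2 b, b \in s & (p%:Z %| n0 + b)%Z].
Proof.
move=> L0; elim: s => [|c s [M [n0 [M0 LM Ln0 Hs Hp]]]].
  by exists L, 0; split=> // p _; left.
have [q qgt qp] := prime_above (D + M).
(* With exponent [K.+1] rather than [K], the prime [q] itself divides [n1 + c] even when [K] is
   0. *)
have cop : coprime M (q ^ K.+1).
  rewrite coprime_sym coprimeXl // prime_coprime //.
  by apply/negP => /(dvdn_leq M0); lia.
have copz : coprimez M%:Z (q ^ K.+1)%N%:Z by [].
set n1 := zchinese M%:Z (q ^ K.+1)%N%:Z n0 (- c).
have n1M : (M%:Z %| n1 - n0)%Z.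
  by rewrite -eqz_mod_dvd; apply/eqP/zchinese_modl.
have n1q : ((q ^ K.+1)%N%:Z %| n1 + c)%Z.
  by rewrite -[c]opprK -eqz_mod_dvd; apply/eqP/zchinese_modr.
have shift (d : nat) (b : int) : (d %| M)%N -> (d%:Z %| n0 + b)%Z ->
    (d%:Z %| n1 + b)%Z.
  move=> dM dn0; have -> : n1 + b = (n1 - n0) + (n0 + b) by ring.
  by rewrite rpredD // (dvdz_trans _ n1M).
exists (M * q ^ K.+1)%N, n1; split.
- by rewrite muln_gt0 M0 expn_gt0 prime_gt0.
- exact: dvdn_mulr.
- by rewrite -[n1]addr0; apply: shift => //; rewrite addr0.
- move=> b; rewrite in_cons => /orP[/eqP->|/Hs[r rp [rM rn]]].
    exists q => //; split; first by rewrite dvdn_mull // dvdn_exp2l.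
    by apply: dvdz_trans n1q; rewrite dvdzE /= dvdn_exp2l.
  by exists r => //; split; [exact: dvdn_mulr | exact: shift].
- move=> p pp; rewrite Euclid_dvdM // => /orP[pM|].
    have [->|[Dp [b bs pb]]] := Hp p pp pM; [by left|right].
    by split=> //; exists b; [rewrite in_cons bs orbT | exact: shift].
  rewrite Euclid_dvdX // => /andP[].
  rewrite dvdn_prime2 // => /eqP-> _; right; split; first by lia.
  exists c; first by rewrite mem_head.
  by apply: dvdz_trans n1q; rewrite dvdzE /= expnS dvdn_mulr.
Qed.

Lemma almost_prime_window (k N : nat) (A : pred int) : Dickson_conjecture ->
  (forall a, A a -> (`|a| <= N)%N /\ almost_prime k a) ->
  exists2 n : nat, (0 < n)%N &
    forall c : int, (`|c| <= N)%N -> almost_prime k.+1 (n%:Z + c) = A c.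
Proof.
move=> dickson HA.
pose win := [seq i%:Z - N%:Z | i <- iota 0 (N + N).+1].
have winP (c : int) : (`|c| <= N)%N -> c \in win.
  move=> cN; apply/mapP; exists `|(c + N%:Z)%R|%N; last by lia.
  by rewrite mem_iota; lia.
have winN (c : int) : c \in win -> (`|c| <= N)%N.
  by move=> /mapP[i]; rewrite mem_iota => iN ->; lia.
pose s := [seq a <- win | A a]; pose t := [seq a <- win | ~~ A a].
pose L := (N`! * N`!)%N.
have L0 : (0 < L)%N by rewrite muln_gt0 fact_gt0.
have [M [n0 [M0 LM Ln0 Ht Hp]]] := simultaneous_prime_powers (N + N) k.+2 t L0.
have sA a : a \in s -> [/\ A a, (0 < `|a|)%N, (`|a| <= N)%N & Omega a = k].
  rewrite mem_filter => /andP[Aa _]; have [aN /andP[a0 /eqP Oa]] := HA _ Aa.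
  by split=> //; rewrite absz_gt0.
(* Squaring [N`!] makes the cofactor [n / |a|] still divisible by [N`!]. *)
have fact_dvd a (n : int) : a \in s -> (L%:Z %| n)%Z ->
    exists2 d : int, n = `|a|%N%:Z * d & (N`!%:Z %| d)%Z.
  move=> /sA[_ a0 aN _] /dvdzP[e ->].
  have /dvdnP[g gE] : (`|a| %| N`!)%N by rewrite dvdn_fact // a0.
  exists (e * g%:Z * N`!%:Z); last by rewrite dvdz_mull.
  by rewrite /L PoszM {1}gE PoszM; ring.
have LMz : (L%:Z %| M%:Z)%Z by [].
pose w (i : 'I_(size s)) : int := s`_i.
have ws i : w i \in s by exact: mem_nth.
(* The linear forms are [(n0 + M * y + w i) / |w i|]. The divisions are exact since [|w i|] divides
   [L], and dividing by [|w i|] instead of [w i] keeps the slopes positive. *)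
pose aa (i : 'I_(size s)) : int := sgz (w i) + (n0 %/ `|w i|%N%:Z)%Z.
pose bb (i : 'I_(size s)) : int := (M%:Z %/ `|w i|%N%:Z)%Z.
have sgzE (a : int) : `|a|%N%:Z * sgz a = a by rewrite mulrC -intEsg.
have fE i (y : int) : `|w i|%N%:Z * (aa i + bb i * y) = n0 + M%:Z * y + w i.
  have si := ws i.
  have [_ a0 _ _] := sA _ si.
  have [d n0E _] := fact_dvd _ _ si Ln0; have [e ME _] := fact_dvd _ _ si LMz.
  rewrite /aa /bb n0E ME !mulKz; [|lia|lia].
  by rewrite !mulrDr sgzE; ring.
(* Discarding the finitely many [m <= |n0|] makes [n0 + M * m] positive. *)
have [m [[m0 mprime] mn0]] : [set m : nat | (0 < m)%N /\ forall i,
    exists2 q : nat, prime q & aa i + bb i * m%:Z = q%:Z] `\`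
    `I_(`|n0|.+1) !=set0.
  apply/infinite_setN0/infinite_setD; last exact: finite_II.
  apply: dickson => [i|p pp].
    have si := ws i.
    have [_ a0 _ _] := sA _ si; have [e ME _] := fact_dvd _ _ si LMz.
    rewrite /bb ME mulKz; [|lia].
    have : 0 < `|w i|%N%:Z * e by rewrite -ME; lia.
    by rewrite pmulr_rgt0 //; lia.
  suff [y Hy] : exists y : int, forall i, ~~ (p%:Z %| aa i + bb i * y)%Z.
    exists y; rewrite dvdzE /= (big_morph absz abszM (erefl : `|1%R|%N = 1%N)).
    by rewrite Euclid_dvd_prod // big1 // => i _; apply/negbTE/Hy.
  case: (boolP (p %| N`!)%N) => [pN|pN].
    exists 0 => i; rewrite mulr0 addr0.
    have si := ws i.
    have [_ a0 _ _] := sA _ si; have [d n0E Nd] := fact_dvd _ _ si Ln0.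
    rewrite /aa n0E mulKz; [|lia].
    have pd : (p%:Z %| d)%Z by apply: dvdz_trans Nd.
    rewrite rpredDr // dvdzE /= absz_sg -absz_gt0 a0 dvdn1.
    by rewrite neq_ltn prime_gt1 // orbT.
  have Np : (N < p)%N.
    by rewrite ltnNge; apply/negP => pN'; move/negP: pN; apply;
      rewrite dvdn_fact // prime_gt0.
  have notdvd (a : int) (e : nat) : (0 < `|a|)%N -> (`|a| <= e)%N ->
      (e < p)%N -> ~~ (p%:Z %| a)%Z.
    by move=> a0 ae ep; apply/negP; rewrite dvdzE /= => /(dvdn_leq a0); lia.
  case: (boolP (p %| M)%N) => [pM|pM].
    have [|[Dp [b bt pb]]] := Hp _ pp pM.
      by rewrite /L Euclid_dvdM // orbb (negPf pN).
    (* Here [p] divides [n0 + b] with [b] outside [A]. If it also divided [n0 + w i], it would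
       divide the difference [w i - b], which is nonzero and at most [2N < p] in absolute value. *)
    exists 0 => i; apply/negP => /(dvdz_mull `|w i|%N%:Z).
    rewrite fE mulr0 addr0 => pa.
    have si := ws i.
    have [Aa a0 aN _] := sA _ si.
    move: bt; rewrite mem_filter /= => /andP[Ab /winN bN].
    have ab : w i != b by apply: contraNneq Ab => <-.
    have : (p%:Z %| w i - b)%Z.
      have -> : w i - b = (n0 + w i) - (n0 + b) by ring.
      exact: rpredB.
    apply/negP; apply: (notdvd _ (N + N)%N) => //.
      by rewrite absz_gt0 subr_eq0.
    by clear -aN bN; lia.
  (* [M] has an inverse [u] modulo [p], so [y = - n0 * u] gives [n0 + M * y = 0] modulo [p]. What
     remains is [w i], nonzero modulo [p] because [0 < |w i| <= N < p]. *)
  have [u [v uv]] := Bezoutz M%:Z p%:Z.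
  have {}uv : u * M%:Z + v * p%:Z = 1.
    rewrite uv; apply/eqP; rewrite -/(coprimez _ _) coprimezE /=.
    by rewrite coprime_sym prime_coprime.
  exists (- (n0 * u)) => i; apply/negP => /(dvdz_mull `|w i|%N%:Z).
  have si := ws i.
  have [_ a0 aN _] := sA _ si.
  rewrite fE (_ : n0 + _ = n0 * v * p%:Z); last first.
    by rewrite -[X in X + _]mulr1 -uv; ring.
  rewrite rpredDl; last by rewrite dvdz_mull.
  by apply/negP; apply: (notdvd _ N).
pose n := n0 + M%:Z * m%:Z.
have n_gt0 : 0 < n by move/negP: mn0; rewrite /n /=; nia.
have nE : n = `|n|%N by lia.
exists `|n|%N => [|c cN]; first by lia.
rewrite -nE; case: (boolP (A c)) => Ac.
  have cs : c \in s by rewrite mem_filter Ac winP.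
  have [_ c0 _ Oc] := sA _ cs.
  have ci : (index c s < size s)%N by rewrite index_mem.
  have wE : w (Ordinal ci) = c by exact: nth_index.
  have [q qp] := mprime (Ordinal ci).
  move=> /(congr1 (fun x => `|c|%N%:Z * x)).
  have := fE (Ordinal ci) m%:Z; rewrite /= wE => -> ncE.
  have q0 : q%:Z != 0 by rewrite -lt0n prime_gt0.
  have c0z : `|c|%N%:Z != 0 by rewrite -lt0n.
  rewrite /almost_prime /n ncE mulf_neq0 //= OmegaM //.
  by rewrite (Omega_prime qp) addn1 eqSS -Oc /Omega /= eqxx.
apply/negP => /andP[nc0 /eqP Onc].
have [|q qp [qM qn]] := Ht c; first by rewrite mem_filter /= Ac winP.
have : ((q ^ k.+2)%N%:Z %| n + c)%Z.
  by rewrite /n addrAC rpredD // dvdz_mulr.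
by move=> /(leq_Omega_dvd nc0); rewrite Omega_primeX // Onc ltnn.
Qed.

(** Convergence in the product topology is coordinatewise, and coordinate [c] of the chosen
    translates is constantly [x c] once [N >= |c|]. *)
Lemma orbit_closure_blocks (x y : biseq) :
  (forall N : nat, exists j : int,
    forall c : int, (`|c| <= N)%N -> y (c + j) = x c) ->
  orbit_closure y x.
Proof.
move=> /choice[j Hj].
apply: (@closed_cvg nat biseq \oo _ (fun N => shiftz (j N) y)).
- exact: closed_closure.
- by apply: nearW => N; apply: subset_closure; exists (j N).
- apply/cvg_sup => c U [V [[W Wo <-] Wx] VU].
  exists `|c|%N => // N /= cN; apply: VU => /=.
  by move: Wx; rewrite /= /proj shiftzE Hj.
Qed.

Theorem proposition5p6 :
  Dickson_conjecture ->
  (forall (k N : nat) (A : set int), (0 < k)%N -> (0 < N)%N ->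
     A `<=` [set` `[1, N%:Z]] `&` Pset k ->
     exists n : nat, (0 < n)%N /\
       [set` `[n%:Z + 1, n%:Z + N%:Z]] `&` Pset k.+1 =
       [set n%:Z + a | a in A]) /\
  (forall k : nat, (0 < k)%N ->
     orbit_closure (indicP k) `<=` orbit_closure (indicP k.+1)).
Proof.
move=> dickson; split=> [k N A _ _ HA|k _].
  have HA1 a : a \in A -> (`|a| <= N)%N /\ almost_prime k a.
    by rewrite inE => /HA[/=]; rewrite in_itv /= => aN ?; split=> //; lia.
  have [n n0 Hn] := almost_prime_window dickson HA1.
  exists n; split=> //; apply/seteqP; split=> [c [/=]|_ [a Aa <-]].
    rewrite in_itv /= => cN ck; exists (c - n%:Z); last by lia.
    have cnN : (`|(c - n%:Z)%R| <= N)%N by lia.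
    by have := Hn _ cnN; rewrite addrC subrK (ck : almost_prime _ c)
      => /esym/set_mem.
  have [/= + _] := HA _ Aa; rewrite !in_itv /= => aN; split; first by lia.
  by rewrite /Pset /= Hn; [exact/mem_set | lia].
suff orb : [set shiftz j (indicP k) | j in [set: int]] `<=`
    orbit_closure (indicP k.+1).
  rewrite /orbit_closure [X in _ `<=` X](closure_id _).1;
    last exact: closed_closure.
  exact: closure_subset.
move=> _ [j _ <-]; apply: orbit_closure_blocks => N.
(* The block of the [j]-th translate on [[-N, N]] is read at the positions [c + j], all within
   [[-W, W]]. *)
pose W := (N + `|j|)%N.
pose A : pred int := [pred a | (`|a| <= W)%N && almost_prime k a].
have HA a : A a -> (`|a| <= W)%N /\ almost_prime k a by move=> /andP.
have [n _ Hn] := almost_prime_window dickson HA.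
exists (n%:Z + j) => c cN; rewrite shiftzE /indicP addrCA Hn /A /=; last by lia.
by have -> : (`|(c + j)%R| <= W)%N by lia.
Qed.
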